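(* Let $\mathcal{X}_{\rm P}=\{x\in\mathbb{R}^n\mid g(x,y)\le 0,\ \forall y\in\Omega_\alpha\}$ with $\Omega_\alpha=\{y\in\Xi\mid P(y)\ge\alpha\}$, and let $$\mathcal{X}_{\rm C}=\Big\{x\in\mathbb{R}^n\ \Big|\ \int\cdots\int_{\mathcal{M}(x)}P(\xi)\,d\xi_u\cdots d\xi_1\ge 1-\beta\Big\},\qquad \mathcal{M}(x)=\{\xi\in\Omega\mid g(x,\xi)\le 0\}.$$ Suppose that $\alpha$ is the value $v$ satisfying $$\int\cdots\int_{\{\xi\in\Omega\mid P(\xi)\ge v\}}P(\xi)\,d\xi_u\cdots d\xi_1=1-\beta .$$ Then: (1) $\mathcal{X}_{\rm P}\subseteq\mathcal{X}_{\rm C}$; (2) $\mathcal{X}_{\rm P}=\mathcal{X}_{\rm C}$ if, for every $x\in\mathbb{R}^n$ and for arbitrary $\xi^{(a)}\in\mathcal{M}(x)$ and $\xi^{(b)}\in\Omega\setminus\mathcal{M}(x)$, one has $P(\xi^{(a)})\ge P(\xi^{(b)})$.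
   Context: $\xi$ is a vector of $u$ uncertain parameters with uncertainty set (sample space) $\Xi\subset(\mathbb{Z}^{u_1},\mathbb{R}^{u_2})$, $u_1+u_2=u$; $\Omega$ denotes the mathematical (constraint-based) description of $\Xi$, i.e. the same set; $P$ is the known probability distribution function of $\xi$ on it. The function $g:\mathbb{R}^n\times\Xi\to\mathbb{R}^m$ is continuous and differentiable, and $g\le 0$ is componentwise. $\beta$ is the tolerated violation probability. $\mathcal{X}_{\rm P}$ is the feasible set of the Probable Event Constrained Optimization (PECO) problem $\min_x f(x)$ s.t. $g(x,y)\le 0\ \forall y\in\Omega_\alpha$; $\mathcal{X}_{\rm C}$ is the feasible set of the chance-constrained problem $\min_x f(x)$ s.t. $\mathbb{P}[g(x,\xi)\le 0]\ge 1-\beta$.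
   Formalization: Part (2) is proved under the additional assumption that every nonempty relatively open part of Ω_α (for each fixed integer part) has positive probability; without it, part (2) fails, e.g. when P has an isolated peak of height exactly α. *)

(* Defs.v *)
From HB Require Import structures.
From mathcomp Require Import all_boot all_order all_algebra.
From mathcomp Require Import all_classical all_reals all_analysis.

Set Implicit Arguments.
Unset Strict Implicit.
Unset Printing Implicit Defensive.

Import Order.TTheory GRing.Theory Num.Theory.
Import numFieldNormedType.Exports.

Local Open Scope classical_set_scope.
Local Open Scope ring_scope.

(** Realizations of u1 integer-valued and u2 real-valued uncertain parameters. *)
Definition outcome (R : realType) (u1 u2 : nat) : Type :=
  ('rV[int]_u1 * 'rV[R]_u2)%type.

Definition slice (R : realType) (u1 u2 : nat) (A : set (outcome R u1 u2))
  (z : 'rV[int]_u1) : set 'rV[R]_u2 := [set y | A (z, y)].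

(** R^k with its Borel sigma-algebra. *)
Definition borel_rV (R : realType) (k : nat) :=
  g_sigma_algebraType (@open 'rV[R]_k).

(** Iterated Lebesgue integral; the first coordinate is integrated last. *)
Fixpoint iter_integral (R : realType) (k : nat) : ('rV[R]_k -> \bar R) -> \bar R :=
  match k with
  | 0 => fun F => F 0
  | k'.+1 => fun F =>
      (\int[@lebesgue_measure R]_t
         iter_integral (fun y : 'rV[R]_k' => F (row_mx (t%:M : 'rV[R]_1) y)))%E
  end.

(** Integral of P over A: integer coordinates are summed, real coordinates are
    integrated. Only meaningful when P is nonnegative on A. *)
Definition prob (R : realType) (u1 u2 : nat) (P : outcome R u1 u2 -> R)
    (A : set (outcome R u1 u2)) : \bar R :=
  (\esum_(z in [set: 'rV[int]_u1])
     iter_integral (fun y : 'rV[R]_u2 => ((EFin \o P) \_ A) (z, y)))%E.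

(** P is a probability density on Xi with respect to the product of the counting
    measure on Z^u1 and the Lebesgue measure on R^u2; its values outside Xi are
    irrelevant. *)
Definition distribution_on (R : realType) (u1 u2 : nat)
    (Xi : set (outcome R u1 u2)) (P : outcome R u1 u2 -> R) : Prop :=
  [/\ forall z : 'rV[int]_u1, measurable (slice Xi z : set (borel_rV R u2)),
      forall z : 'rV[int]_u1,
        measurable_fun (slice Xi z : set (borel_rV R u2))
          ((fun y => P (z, y)) : borel_rV R u2 -> R),
      forall xi, Xi xi -> 0 <= P xi &
      prob P Xi = 1%E].

(** Differentiability relative to D, so that nothing is assumed about f off D. *)
Definition differentiable_within (R : realType) (V W : normedModType R)
    (D : set V) (f : V -> W) (p : V) : Prop :=
  exists2 df : {linear V -> W}, continuous df &
    forall e : R, 0 < e -> \forall q \near within D (nbhs p),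
      `|f q - f p - df (q - p)| <= e * `|q - p|.

(** Z^u1 being discrete, continuity and differentiability on R^n x Xi are those of
    (x, y) |-> g(x, (z, y)) for each fixed integer part z. *)
Definition continuous_differentiable_on (R : realType) (n m u1 u2 : nat)
    (Xi : set (outcome R u1 u2))
    (g : 'rV[R]_n -> outcome R u1 u2 -> 'rV[R]_m) : Prop :=
  forall z : 'rV[int]_u1,
    let D := [set p : 'rV[R]_n * 'rV[R]_u2 | Xi (z, p.2)] in
    let G := fun p : 'rV[R]_n * 'rV[R]_u2 => g p.1 (z, p.2) in
    {within D, continuous G} /\ forall p, D p -> differentiable_within D G p.

Definition rV_le0 (R : realType) (m : nat) (v : 'rV[R]_m) : Prop :=
  forall i : 'I_m, v 0 i <= 0.

Definition Omega_ge (R : realType) (u1 u2 : nat) (Xi : set (outcome R u1 u2))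
    (P : outcome R u1 u2 -> R) (v : R) : set (outcome R u1 u2) :=
  [set y | Xi y /\ v <= P y].

Definition Mset (R : realType) (n m u1 u2 : nat) (Xi : set (outcome R u1 u2))
    (g : 'rV[R]_n -> outcome R u1 u2 -> 'rV[R]_m) (x : 'rV[R]_n) :
    set (outcome R u1 u2) :=
  [set xi | Xi xi /\ rV_le0 (g x xi)].

Definition X_P (R : realType) (n m u1 u2 : nat) (Xi : set (outcome R u1 u2))
    (P : outcome R u1 u2 -> R)
    (g : 'rV[R]_n -> outcome R u1 u2 -> 'rV[R]_m) (alpha : R) : set 'rV[R]_n :=
  [set x | forall y, Omega_ge Xi P alpha y -> rV_le0 (g x y)].

Definition X_C (R : realType) (n m u1 u2 : nat) (Xi : set (outcome R u1 u2))
    (P : outcome R u1 u2 -> R)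
    (g : 'rV[R]_n -> outcome R u1 u2 -> 'rV[R]_m) (beta : R) : set 'rV[R]_n :=
  [set x | ((1 - beta)%:E <= prob P (Mset Xi g x))%E].

(** Every nonempty relatively open subset of A has positive probability. Equality of
    the two feasible sets fails without this for A = Omega_ge Xi P alpha, since X_P
    constrains every point of A whereas X_C ignores null sets. It holds as soon as
    u2 = 0 and P > 0 on A. *)
Definition no_null_open_part (R : realType) (u1 u2 : nat)
    (P : outcome R u1 u2 -> R) (A : set (outcome R u1 u2)) : Prop :=
  forall (z : 'rV[int]_u1) (U : set 'rV[R]_u2), open U ->
    let B := A `&` [set xi | xi.1 = z /\ U xi.2] in
    B !=set0 -> (0 < prob P B)%E.

(* Main.v *)
Require Import Defs.
From mathcomp Require Import all_boot all_order all_algebra.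
From mathcomp Require Import all_classical all_reals all_analysis.

Set Implicit Arguments.
Unset Strict Implicit.
Unset Printing Implicit Defensive.

Import Order.TTheory GRing.Theory Num.Theory.
Import numFieldNormedType.Exports.

Local Open Scope classical_set_scope.
Local Open Scope ring_scope.

(** Why the theorem is true.  On Xi the density is nonnegative, so [prob P] is
    monotone there.  If x is in X_P then Omega_alpha is contained in M(x), and
    the latter has probability at least that of Omega_alpha, namely 1 - beta:
    this is part (1).

    Conversely let x be in X_C and suppose that a point y0 of Omega_alpha
    violates the constraints at x.  The ordering hypothesis, applied to y0,
    says that P >= P y0 >= alpha throughout M(x), so M(x) is contained in
    Omega_alpha.  Some component of g(x, y0) is positive, and by continuity it
    stays positive at the points of Xi near y0 with the same integer part; those
    which lie in Omega_alpha form a relatively open part B, disjoint from M(x)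
    and of positive probability.  Then
      1 - beta < prob M(x) + prob B <= prob Omega_alpha = 1 - beta,
    which is absurd.

    The probabilities are iterated integrals, of which the last display uses
    superadditivity only.  The integral of a nonnegative function, being a
    supremum of integrals of simple functions below it, is monotone and
    superadditive for arbitrary functions ([ge0_integral_homo],
    [ge0_integral_superadditive]), so that no Tonelli argument on the sections
    of M(x) and B enters.  Both properties pass through the iteration and the
    sum over the integer part to [prob] ([prob_subset], [prob_superadditive]). *)

(** * Lower integrals of arbitrary nonnegative functions *)

(** The supremum on the right is taken over more simple functions. *)
Lemma ge0_integral_homo d (T : measurableType d) (R : realType)
    (mu : {measure set T -> \bar R}) (f g : T -> \bar R) :
  (forall t, 0 <= f t)%E -> (forall t, f t <= g t)%E ->
  (\int[mu]_t f t <= \int[mu]_t g t)%E.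
Proof.
move=> f0 fg; have g0 t : (0 <= g t)%E by exact: le_trans (f0 t) (fg t).
rewrite !ge0_integralTE//; apply: ereal_sup_le => _ /= [h hf <-].
by exists h => // t; exact: le_trans (hf t) (fg t).
Qed.

Section superadditivity.
Import HBNNSimple.

(** If h1 <= f and h2 <= g are simple, then h1 + h2 is a simple function below
    f + g, and the integral is additive on simple functions. *)
Lemma ge0_integral_superadditive d (T : measurableType d) (R : realType)
    (mu : {measure set T -> \bar R}) (f g : T -> \bar R) :
  (forall t, 0 <= f t)%E -> (forall t, 0 <= g t)%E ->
  (\int[mu]_t f t + \int[mu]_t g t <= \int[mu]_t (f t + g t))%E.
Proof.
move=> f0 g0; have fg0 t : (0 <= f t + g t)%E by exact: adde_ge0.
have [->|fg_fin] := eqVneq (\int[mu]_t (f t + g t))%E +oo%E; first exact: leey.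
have fin u : (0 <= u -> u <= \int[mu]_t (f t + g t) -> u \is a fin_num)%E.
  move=> u0 ule; rewrite ge0_fin_numE//; apply: le_lt_trans ule _.
  by rewrite ltey.
have f_fin : (\int[mu]_t f t)%E \is a fin_num.
  apply: fin; first exact: integral_ge0.
  by apply: ge0_integral_homo => // t; rewrite leeDl.
have g_fin : (\int[mu]_t g t)%E \is a fin_num.
  apply: fin; first exact: integral_ge0.
  by apply: ge0_integral_homo => // t; rewrite leeDr.
(* The sum is finite, so each supremum can be bounded with the other term
   moved to the right. *)
rewrite -leeBrDr// [leLHS]ge0_integralTE//; apply: ge_ereal_sup => _ /= [h1 h1f <-].
have h1_fin : sintegral mu h1 \is a fin_num.
  rewrite ge0_fin_numE ?sintegral_ge0//.
  apply: le_lt_trans (_ : \int[mu]_t f t < +oo)%E; last by rewrite ltey_eq f_fin.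
  by rewrite ge0_integralTE//; apply: ereal_sup_ubound; exists h1.
rewrite leeBrDr// -leeBrDl// [leLHS]ge0_integralTE//.
apply: ge_ereal_sup => _ /= [h2 h2g <-].
rewrite leeBrDl// -sintegralD ge0_integralTE//; apply: ereal_sup_ubound.
exists (add_nnsfun h1 h2) => //= t.
by rewrite EFinD; apply: leeD.
Qed.

End superadditivity.

(** * Monotonicity and superadditivity of probabilities *)

Lemma iter_integral_ge0 (R : realType) (k : nat) (F : 'rV[R]_k -> \bar R) :
  (forall y, 0 <= F y)%E -> (0 <= iter_integral F)%E.
Proof.
elim: k F => [|k IH] F F0 /=; first exact: F0.
by apply: integral_ge0 => t _; apply: IH => y; exact: F0.
Qed.

Lemma iter_integral_homo (R : realType) (k : nat) (F G : 'rV[R]_k -> \bar R) :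
  (forall y, 0 <= F y)%E -> (forall y, F y <= G y)%E ->
  (iter_integral F <= iter_integral G)%E.
Proof.
elim: k F G => [|k IH] F G F0 FG /=; first exact: FG.
apply: ge0_integral_homo => t; first by apply: iter_integral_ge0 => y; exact: F0.
by apply: IH => y; [exact: F0|exact: FG].
Qed.

Lemma iter_integral_superadditive (R : realType) (k : nat)
    (F G : 'rV[R]_k -> \bar R) :
  (forall y, 0 <= F y)%E -> (forall y, 0 <= G y)%E ->
  (iter_integral F + iter_integral G <= iter_integral (fun y => F y + G y))%E.
Proof.
elim: k F G => [|k IH] F G F0 G0 //=.
apply: le_trans (ge0_integral_superadditive _ _ _) _ => [t|t|].
- by apply: iter_integral_ge0 => y; exact: F0.
- by apply: iter_integral_ge0 => y; exact: G0.
apply: ge0_integral_homo => t.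
  by apply: adde_ge0; apply: iter_integral_ge0 => y; [exact: F0|exact: G0].
by apply: IH => y; [exact: F0|exact: G0].
Qed.

Section prob_theory.
Variables (R : realType) (u1 u2 : nat) (P : outcome R u1 u2 -> R).
Implicit Types A B C : set (outcome R u1 u2).

Let restrict_ge0 A : (forall xi, A xi -> 0 <= P xi) ->
  forall xi, (0 <= ((EFin \o P) \_ A) xi)%E.
Proof.
move=> P0 xi; rewrite patchE; case: ifPn => [/set_mem Axi|//].
by rewrite lee_fin; exact: P0.
Qed.

Lemma prob_subset A B : (forall xi, B xi -> 0 <= P xi) -> A `<=` B ->
  (prob P A <= prob P B)%E.
Proof.
move=> P0 AB; have PA0 xi : A xi -> 0 <= P xi by move=> /AB; exact: P0.
apply: le_esum => z _; apply: iter_integral_homo => y; first exact: restrict_ge0.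
rewrite !patchE; case: ifPn => [/set_mem/AB Bxi|_]; first by rewrite mem_set.
by move: (restrict_ge0 P0 (z, y)); rewrite patchE.
Qed.

Lemma prob_superadditive A B C : (forall xi, C xi -> 0 <= P xi) ->
  A `<=` C -> B `<=` C -> A `&` B = set0 -> (prob P A + prob P B <= prob P C)%E.
Proof.
move=> P0 AC BC AB0.
have PA0 xi : A xi -> 0 <= P xi by move=> /AC; exact: P0.
have PB0 xi : B xi -> 0 <= P xi by move=> /BC; exact: P0.
rewrite /prob -esumD; first last.
- by move=> z _; apply: iter_integral_ge0 => y; exact: restrict_ge0.
- by move=> z _; apply: iter_integral_ge0 => y; exact: restrict_ge0.
apply: le_esum => z _.
apply: le_trans (iter_integral_superadditive _ _) _ => [y|y|].
- exact: restrict_ge0.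
- exact: restrict_ge0.
apply: iter_integral_homo => y; first by apply: adde_ge0; exact: restrict_ge0.
rewrite !patchE.
case: ifPn => [/set_mem Axi|_]; case: ifPn => [/set_mem Bxi|_].
- by have : (A `&` B) (z, y) by []; rewrite AB0.
- by rewrite adde0 mem_set//; exact: AC.
- by rewrite add0e mem_set//; exact: BC.
- by rewrite adde0; move: (restrict_ge0 P0 (z, y)); rewrite patchE.
Qed.

End prob_theory.

(** * Violation of a constraint is an open condition *)

(** A positive component of g(x, _) stays positive near y by continuity along
    the fibre over x of the product R^n x Xi. *)
Lemma open_violation (R : realType) (n m u1 u2 : nat)
    (Xi : set (outcome R u1 u2)) (g : 'rV[R]_n -> outcome R u1 u2 -> 'rV[R]_m)
    (x : 'rV[R]_n) (z : 'rV[int]_u1) (y : 'rV[R]_u2) :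
  continuous_differentiable_on Xi g -> Xi (z, y) -> ~ rV_le0 (g x (z, y)) ->
  exists U : set 'rV[R]_u2, [/\ open U, U y &
    forall y', U y' -> Xi (z, y') -> ~ rV_le0 (g x (z, y'))].
Proof.
move=> /(_ z)[/subspace_continuousP /(_ (x, y)) gcont _] Xiy.
move=> /existsNP[i /negP]; rewrite -ltNge => gi0.
have [|] := gcont Xiy [set v : 'rV[R]_m | 0 < v 0 i].
  have : nbhs (g x (z, y) 0 i) [set r : R | 0 < r].
    by apply: open_nbhs_nbhs; split; first exact: open_gt.
  exact: coord_continuous.
move=> [V W] /= [Vx Wy] VW.
exists W°; split; [exact: open_interior|exact: Wy|] => y' /interior_subset Wy' Xiy'.
move=> /(_ i); apply/negP; rewrite -ltNge.
by apply: (VW (x, y')) => //; split => //; exact: nbhs_singleton Vx.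
Qed.

Theorem proposition2p2 (R : realType) (n m u1 u2 : nat)
    (Xi : set (outcome R u1 u2)) (P : outcome R u1 u2 -> R)
    (g : 'rV[R]_n -> outcome R u1 u2 -> 'rV[R]_m) (alpha beta : R)
    (hP : distribution_on Xi P)
    (hg : continuous_differentiable_on Xi g)
    (halpha : prob P (Omega_ge Xi P alpha) = (1 - beta)%:E) :
  X_P Xi P g alpha `<=` X_C Xi P g beta /\
  (no_null_open_part P (Omega_ge Xi P alpha) ->
   (forall (x : 'rV[R]_n) (xa xb : outcome R u1 u2),
      Mset Xi g x xa -> (Xi `\` Mset Xi g x) xb -> P xb <= P xa) ->
   X_P Xi P g alpha = X_C Xi P g beta).
Proof.
have [_ _ P0 _] := hP.
have sub : X_P Xi P g alpha `<=` X_C Xi P g beta.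
  move=> x xP; rewrite /X_C /= -halpha; apply: prob_subset.
    by move=> xi [/P0].
  by move=> y Oy; split; [case: Oy|exact: xP].
split=> // no_null ordered; apply/seteqP; split=> // x; rewrite /X_C /= => xC.
move=> [z y] [Xiy alphay]; apply: contrapT => viol.
have [U [Uo Uy Uviol]] := open_violation hg Xiy viol.
pose B := Omega_ge Xi P alpha `&` [set xi | xi.1 = z /\ U xi.2].
have B_gt0 : (0 < prob P B)%E by apply: no_null => //; exists (z, y).
have M_sub : Mset Xi g x `<=` Omega_ge Xi P alpha.
  move=> xi Mxi; split; first by case: Mxi.
  by apply: le_trans alphay (ordered _ _ _ Mxi _); split => // -[].
have MB0 : Mset Xi g x `&` B = set0.
  by apply/seteqP; split=> // -[z' y'] [[Xiy' le0] [_ [/= zz' Uy']]];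
     subst z'; exact: Uviol Uy' Xiy' le0.
have Omega_ge0 xi : Omega_ge Xi P alpha xi -> 0 <= P xi by case=> /P0.
have B_sub : B `<=` Omega_ge Xi P alpha by move=> xi [].
have := prob_superadditive Omega_ge0 M_sub B_sub MB0.
rewrite halpha leNgt => /negP; apply.
rewrite -[ltLHS]adde0; exact: lee_ltD.
Qed.
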